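(* Let $X$ be a Banach space, $P\in L(X)$, and let $M\colon D(M)\subseteq X\to X$ be closable, with closure $\overline{M}$. Then the following statements are equivalent: (i) $M$ is n-strongly $P$-compatible; (ii) $\overline{M}$ is n-strongly $P$-compatible.
   Context: For a Banach space $X$, $L(X)$ denotes the bounded linear operators on $X$, $X'$ the dual space, and $|\cdot|$ the norm of $X$. The map $M$ is not assumed to be linear. It is closable if the norm closure in $X\times X$ of its graph is again the graph of a map; this map is $\overline{M}$. A map $N\colon D(N)\subseteq X\to X$ is n-strongly (norm-strongly) $P$-compatible if for all $R>0$ and $x'\in X'$ the map $B_N(0,R)\to X$, $f\mapsto Nf$, is uniformly continuous when $B_N(0,R):=\{f\in D(N): |f|+|Nf|<R\}$ carries the pseudometric $(f,g)\mapsto|P(f-g)|$ and $X$ carries the pseudometric $(u,v)\mapsto|\langle P(u-v),x'\rangle|$. *)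

(* Defs.v *)
From HB Require Import structures.
From mathcomp Require Import all_boot all_order all_algebra.
From mathcomp Require Import all_classical all_reals topology normedtype.

Set Implicit Arguments.
Unset Strict Implicit.
Unset Printing Implicit Defensive.

Import Order.TTheory GRing.Theory Num.Theory.
Import numFieldNormedType.Exports.

Local Open Scope classical_set_scope.
Local Open Scope ring_scope.

(* A map N : D(N) `<=` X -> X, not necessarily linear. The values of [pfun]
   outside [dom] are junk: no definition below depends on them. *)
Record partial_map (X : Type) := PartialMap {
  dom : set X;
  pfun :> X -> X
}.

Definition graph (X : Type) (N : partial_map X) : set (X * X) :=
  [set u | dom N u.1 /\ u.2 = N u.1].

Section Closure.
Context {K : numFieldType} {X : normedModType K}.
Implicit Type M : partial_map X.

Definition closable M : Prop :=
  exists N : partial_map X, graph N = closure (graph M).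

(* Meaningful only when [M] is closable, see [graph_map_closure]. *)
Definition map_closure M : partial_map X :=
  PartialMap
    [set f | exists h, closure (graph M) (f, h)]
    (fun f => xget 0 [set h | closure (graph M) (f, h)]).

Lemma graph_map_closure M :
  closable M -> graph (map_closure M) = closure (graph M).
Proof.
move=> [N NM]; apply/seteqP; split=> -[f h].
- by move=> [[k fk] /= ->]; exact: (@xgetPex _ 0 [set h | closure (graph M) (f, h)] (ex_intro _ k fk)).
- move=> fh; split; first by exists h.
  have : closure (graph M) (f, map_closure M f).
    exact: (@xgetPex _ 0 [set k | closure (graph M) (f, k)] (ex_intro _ h fh)).
  by move: fh; rewrite -NM => -[/= _ ->] [/= _ ->].
Qed.

End Closure.

Definition unif_continuous_on (K : numDomainType) (T U : Type)
    (dT : T -> T -> K) (dU : U -> U -> K) (A : set T) (h : T -> U) : Prop :=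
  forall e : K, 0 < e -> exists2 d : K, 0 < d &
    forall f g, A f -> A g -> dT f g < d -> dU (h f) (h g) < e.

Section Compatibility.
Context {K : numFieldType} {X : normedModType K}.

Definition graph_ball (N : partial_map X) (R : K) : set X :=
  [set f | dom N f /\ `|f| + `|N f| < R].

(* For linear maps, [bounded_near _ (nbhs 0)] is boundedness in operator norm
   ([linear_boundedP]), so [x'] ranges over the dual space of [X]. The scalars
   [K] may be real or complex: in either case [0 < R] makes [R] a positive
   real. *)
Definition n_strongly_compatible (P : {linear X -> X}) (N : partial_map X) : Prop :=
  forall (R : K) (x' : {linear X -> K^o}),
    0 < R -> bounded_near x' (nbhs (0 : X)) ->
    unif_continuous_on
      (fun f g => `|P (f - g)|)
      (fun u v => `|x' (P (u - v))|)
      (graph_ball N R) N.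

End Compatibility.

(* Main.v *)
(* All conditions in the definition of compatibility are strict inequalities
   between continuous functions of the graph points, so they survive replacing
   points of the closed graph by nearby points of the graph of M; the modulus d
   for e / 2 and M then serves for e and the closure. *)
Require Import Defs.
From mathcomp Require Import all_boot all_order all_algebra.
From mathcomp Require Import all_classical all_reals topology normedtype.

Import Order.TTheory GRing.Theory Num.Theory.
Import numFieldNormedType.Exports.

Local Open Scope classical_set_scope.
Local Open Scope ring_scope.

(** The point [(f, map_closure M f)] lies in the closure of [graph M], so each of its product
    neighbourhoods [A * B] meets [graph M]. Both [S] and [T] are handled at once because a single
    [f'] must be close for the pseudometric of the domain and for that of the values. *)
Lemma graph_ball_closure_approx {K : numFieldType} {X V W : normedModType K}
    {M : partial_map X} (S : {linear X -> V}) (T : {linear X -> W}) {R : K}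
    {f : X} {r s : K} :
  closable M -> continuous S -> continuous T ->
  graph_ball (map_closure M) R f -> 0 < r -> 0 < s ->
  exists f', [/\ graph_ball M R f', `|S (f - f')| < r &
                 `|T (map_closure M f - M f')| < s].
Proof.
move=> hM cS cT [domf fR] r0 s0.
have fcl : closure (graph M) (f, map_closure M f).
  by rewrite -(graph_map_closure hM); split.
(* Half of the slack in the ball condition goes to each coordinate, so that the bounds [|f| + t] and
   [|map_closure M f| + t] add up to [R]. *)
have t0 : 0 < (R - (`|f| + `|map_closure M f|)) / 2 by rewrite divr_gt0 ?subr_gt0.
set t := (X in 0 < X) in t0.
set A := [set x | `|f - x| < t /\ `|S f - S x| < r].
set B := [set y | `|map_closure M f - y| < t /\ `|T (map_closure M f) - T y| < s].
have nbhs_fMf : nbhs (f, map_closure M f) (A `*` B).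
  exists (A, B) => //.
  split; apply: filterI.
  - exact: (cvgr_dist_lt _ _ cvg_id _ t0).
  - exact: (cvgr_dist_lt _ _ (cS f) _ r0).
  - exact: (cvgr_dist_lt _ _ cvg_id _ t0).
  - exact: (cvgr_dist_lt _ _ (cT _) _ s0).
have [[f' h] [[/= domf' ->] [/= [ff' Sff'] [Mff' TMff']]]] := fcl _ nbhs_fMf.
exists f'; split; rewrite ?linearB//; split=> //.
have -> : R = (`|f| + t) + (`|map_closure M f| + t).
  by rewrite addrACA -splitr addrC subrK.
by apply: ltrD; rewrite -ltrBlDl; apply: le_lt_trans (lerB_dist _ _) _;
  rewrite distrC.
Qed.

(** [graph M] lies in its closure, which closability makes the graph of [map_closure M]. *)
Lemma map_closureE {K : numFieldType} {X : normedModType K} {M : partial_map X}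
    {f : X} :
  closable M -> dom M f -> dom (map_closure M) f /\ M f = map_closure M f.
Proof.
move=> hM domf; suff : graph (map_closure M) (f, M f) by [].
by rewrite (graph_map_closure hM); apply: subset_closure.
Qed.

Theorem lemma1p0p2 (K : numFieldType) (X : completeNormedModType K)
  (P : {linear X -> X}) (hP : bounded_near P (nbhs (0 : X)))
  (M : partial_map X) (hM : closable M) :
  n_strongly_compatible P M <-> n_strongly_compatible P (map_closure M).
Proof.
have cP : continuous P by exact/linear_bounded_continuous.
split=> Mcomp R x' R0 bx' e e0.
(* Half of [e] is for the modulus of [M], a quarter for each of the two approximation errors in the
   values. *)
- have e20 : 0 < e / 2 by rewrite divr_gt0.
  have e40 : 0 < e / 2 / 2 by rewrite divr_gt0.
  have [d d0 Md] := Mcomp R x' R0 bx' _ e20.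
  have cx' : continuous x' by exact/linear_bounded_continuous.
  have cxP : continuous (x' \o P) by move=> x; exact: continuous_comp (cP x) (cx' _).
  exists d => // f g fR gR fgd.
  (* Moving [f] and [g] by less than half the slack each, as seen through [P], keeps the distance
     below [d]. *)
  have r0 : 0 < (d - `|P (f - g)|) / 2 by rewrite divr_gt0 ?subr_gt0.
  have [f' [f'R Pff' xff']] :=
    graph_ball_closure_approx P (x' \o P) hM cP cxP fR r0 e40.
  have [g' [g'R Pgg' xgg']] :=
    graph_ball_closure_approx P (x' \o P) hM cP cxP gR r0 e40.
  (* Used twice: to pass from [f - g] to [f' - g'], and from the values of [M] back to those of the
     closure. *)
  have diffE (a b a' b' : X) : a - b = (a' - b') + ((a - a') - (b - b')).
    by rewrite opprB addrACA addKr [a' + _]addrC subrK.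
  have Pf'g' : `|P (f' - g')| < d.
    rewrite (diffE _ _ f g) linearD.
    apply: le_lt_trans (ler_normD _ _) _; rewrite -ltrBrDl [P (_ - _ - _)]linearB.
    apply: le_lt_trans (ler_normB _ _) _; rewrite [ltRHS]splitr.
    by rewrite !linearB [X in X + _]distrC [X in _ + X]distrC -!linearB ltrD.
  rewrite (diffE _ _ (M f') (M g')) [P _]linearD [x' _]linearD.
  apply: le_lt_trans (ler_normD _ _) _; rewrite [ltRHS]splitr.
  apply: ltrD; first exact: Md.
  rewrite [P (_ - _ - _)]linearB [x' (_ - _)]linearB.
  by apply: le_lt_trans (ler_normB _ _) _; rewrite [ltRHS]splitr ltrD.
(* The closure extends [M] with the same values, hence its ball of radius [R] contains that of [M]
   and the same [d] works. *)
- have [d d0 Md] := Mcomp R x' R0 bx' _ e0.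
  have sub f : graph_ball M R f -> graph_ball (map_closure M) R f.
    by move=> [/(map_closureE hM)[domf Mf]]; rewrite Mf.
  exists d => // f g fR gR fgd.
  rewrite (map_closureE hM fR.1).2 (map_closureE hM gR.1).2.
  exact: Md (sub _ fR) (sub _ gR) fgd.
Qed.
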